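(* The mappings $\varepsilon^i$, $i=1,2,3$, are symmetries of the exponential mapping of timelike normal extremals, i.e. $$(\varepsilon^i\circ\mathrm{Exp})(\theta,c,\alpha,t)=(\mathrm{Exp}\circ\varepsilon^i)(\theta,c,\alpha,t),\qquad (\theta,c,\alpha,t)\in N.$$
   Context: Timelike normal extremals in the sub-Lorentzian Engel group $M=\mathbb{R}^4$ (coordinates $q=(x_1,x_2,y,z)$), on the level $H=-1/2$ with $h_1=\cosh\theta$, $h_2=\sinh\theta$, $h_3=c$, $h_4=\alpha$, satisfy $$\dot x_1=-\cosh\theta,\ \dot x_2=\sinh\theta,\ \dot y=\tfrac12(x_2\cosh\theta+x_1\sinh\theta),\ \dot z=\tfrac{x_1^2+x_2^2}{2}\sinh\theta,\ \dot\theta=-c,\ \dot c=-\alpha\cosh\theta,\ \dot\alpha=0,$$ with $q(0)=0$. Let $C=\{\lambda=(\theta,c,\alpha)\in\mathbb{R}^3\}$. For $\lambda\in C$ let $t_{\mathrm{supr}}(\lambda)\in(0,+\infty]$ be the explosion (maximal forward existence) time of the solution with initial values $\lambda$, $q(0)=0$; let $N=\{(\lambda,t): \lambda\in C,\ 0<t<t_{\mathrm{supr}}(\lambda)\}$ and $\mathrm{Exp}:N\to M$, $\mathrm{Exp}(\lambda,t)=q(t)$. Action on $N$: on $C$ put $\varepsilon^1(\theta,c,\alpha)=(-\theta,-c,-\alpha)$, $\varepsilon^2(\theta,c,\alpha)=(\theta,-c,\alpha)$, $\varepsilon^3(\theta,c,\alpha)=(-\theta,c,-\alpha)$, and let $e^{t\vec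 H_v}$ be the flow on $C$ of $\vec H_v=-c\,\partial_\theta-\alpha\cosh\theta\,\partial_c$. Then $\varepsilon^1(\lambda,t)=(\varepsilon^1(\lambda),t)$ and $\varepsilon^i(\lambda,t)=(\varepsilon^i\circ e^{t\vec H_v}(\lambda),t)$ for $i=2,3$. Action on $M$: $\varepsilon^1(x_1,x_2,y,z)=(x_1,-x_2,-y,-z)$, $\varepsilon^2(x_1,x_2,y,z)=(x_1,x_2,-y,z-x_1y)$, $\varepsilon^3(x_1,x_2,y,z)=(x_1,-x_2,y,x_1y-z)$. *)

(* Defs.v *)
From Stdlib Require Import Reals ClassicalEpsilon.
From Coquelicot Require Import Coquelicot.
Open Scope R_scope.

Section AutonomousODE.

Context {V : NormedModule R_AbsRing}.

Definition integral_curve (X : V -> V) (x0 : V) (a b : R) (g : R -> V) : Prop :=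
  a < 0 < b /\ g 0 = x0 /\ forall s, a < s < b -> is_derive g s (X (g s)).

(** The right end of the maximal interval of existence; integral curves live
    on open intervals around the initial time [0], so all derivatives are
    two-sided. *)
Definition explosion_time (X : V -> V) (x0 : V) : Rbar :=
  Lub_Rbar (fun b => exists a g, integral_curve X x0 a b g).

(** [flow X t x0] is the value at time [t] of the solution starting at [x0];
    it is unspecified when no integral curve reaches time [t].  For locally
    Lipschitz [X] the value does not depend on the integral curve chosen. *)
Definition flow (X : V -> V) (t : R) (x0 : V) : V :=
  epsilon (inhabits x0) (fun x =>
    exists a b g, integral_curve X x0 a b g /\ a < t < b /\ g t = x).

End AutonomousODE.

(** Coordinates [(x1, x2, y, z)] on the Engel group. *)
Definition Engel : Type := (R * R * R * R)%type.

(** Coordinates [(theta, c, alpha)]. *)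
Definition Costate : Type := (R * R * R)%type.

Definition vertical_field (l : Costate) : Costate :=
  let '(theta, c, alpha) := l in (- c, - alpha * cosh theta, 0).

Definition horizontal_field (q : Engel) (theta : R) : Engel :=
  let '(x1, x2, y, z) := q in
  (- cosh theta,
   sinh theta,
   / 2 * (x2 * cosh theta + x1 * sinh theta),
   (x1 ^ 2 + x2 ^ 2) / 2 * sinh theta).

Definition extremal_field (p : Engel * Costate) : Engel * Costate :=
  let '(q, l) := p in
  let '(theta, c, alpha) := l in
  (horizontal_field q theta, vertical_field l).

Definition engel_origin : Engel := (0, 0, 0, 0).

Definition t_supr (l : Costate) : Rbar :=
  explosion_time extremal_field (engel_origin, l).

Definition exp_domain (n : Costate * R) : Prop :=
  let '(l, t) := n in 0 < t /\ Rbar_lt t (t_supr l).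

Definition Exp (n : Costate * R) : Engel :=
  let '(l, t) := n in fst (flow extremal_field t (engel_origin, l)).

Definition epsC1 (l : Costate) : Costate :=
  let '(theta, c, alpha) := l in (- theta, - c, - alpha).
Definition epsC2 (l : Costate) : Costate :=
  let '(theta, c, alpha) := l in (theta, - c, alpha).
Definition epsC3 (l : Costate) : Costate :=
  let '(theta, c, alpha) := l in (- theta, c, - alpha).

Definition epsN1 (n : Costate * R) : Costate * R :=
  let '(l, t) := n in (epsC1 l, t).
Definition epsN2 (n : Costate * R) : Costate * R :=
  let '(l, t) := n in (epsC2 (flow vertical_field t l), t).
Definition epsN3 (n : Costate * R) : Costate * R :=
  let '(l, t) := n in (epsC3 (flow vertical_field t l), t).

Definition epsM1 (q : Engel) : Engel :=
  let '(x1, x2, y, z) := q in (x1, - x2, - y, - z).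
Definition epsM2 (q : Engel) : Engel :=
  let '(x1, x2, y, z) := q in (x1, x2, - y, z - x1 * y).
Definition epsM3 (q : Engel) : Engel :=
  let '(x1, x2, y, z) := q in (x1, - x2, y, x1 * y - z).

(* Main.v *)
Require Import Defs.
From Stdlib Require Import Reals ClassicalEpsilon Lra.
From Coquelicot Require Import Coquelicot.
Open Scope R_scope.

(** The vector fields are locally Lipschitz, so any integral curve may be used
    to compute [Exp] and [flow].  The symmetry [epsC1] maps trajectories to
    trajectories by changing signs.  For [epsC2], if [(q, l)] is a trajectory
    on [[0, t]], then reversing time and changing the sign of [c] gives a
    vertical trajectory from [epsC2 (l t)]; its horizontal lift from the origin
    is an explicit polynomial in [q t] and [q (t - s)], and at [s = t] it equals
    [epsM2 (q t)].  Finally [eps3 = eps1 o eps2]. *)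

(** * Integral curves in real coordinates *)

Lemma is_derive_pair {U V : NormedModule R_AbsRing} (f : R -> U) (g : R -> V)
    (s : R) (l : U) (m : V) :
  is_derive (fun u => (f u, g u)) s (l, m) <->
  is_derive f s l /\ is_derive g s m.
Proof.
split.
- intros H; split.
  + exact (filterdiff_comp' _ _ s _ _ H
             (filterdiff_linear _ is_linear_fst)).
  + exact (filterdiff_comp' _ _ s _ _ H
             (filterdiff_linear _ is_linear_snd)).
- intros [Hf Hg].
  exact (filterdiff_comp'_2 f g pair s _ _ pair Hf Hg
           (filterdiff_linear _
              (is_linear_prod _ _ is_linear_fst is_linear_snd))).
Qed.

Lemma is_derive_vertical (th c al : R -> R) (s : R) :
  is_derive (fun u => (th u, c u, al u)) s (vertical_field (th s, c s, al s)) <->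
  is_derive th s (- c s) /\ is_derive c s (- al s * cosh (th s)) /\
  is_derive al s 0.
Proof.
unfold vertical_field; rewrite !is_derive_pair; tauto.
Qed.

Lemma is_derive_horizontal (x1 x2 y z : R -> R) (th s : R) :
  is_derive (fun u => (x1 u, x2 u, y u, z u)) s
    (horizontal_field (x1 s, x2 s, y s, z s) th) <->
  is_derive x1 s (- cosh th) /\ is_derive x2 s (sinh th) /\
  is_derive y s (/ 2 * (x2 s * cosh th + x1 s * sinh th)) /\
  is_derive z s ((x1 s ^ 2 + x2 s ^ 2) / 2 * sinh th).
Proof.
unfold horizontal_field; rewrite !is_derive_pair; tauto.
Qed.

Lemma integral_curve_ext {V : NormedModule R_AbsRing} (X : V -> V) (x0 : V)
    (a b : R) (g h : R -> V) :
  (forall s, g s = h s) -> integral_curve X x0 a b g ->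
  integral_curve X x0 a b h.
Proof.
intros E [Hab [H0 Hd]]; split; [exact Hab | split].
- now rewrite <- E.
- intros s Hs; rewrite <- E; apply is_derive_ext with g; auto.
Qed.

Lemma vertical_curve_coordinates l a b v :
  integral_curve vertical_field l a b v ->
  exists th c al : R -> R,
    (forall s, v s = (th s, c s, al s)) /\
    integral_curve vertical_field l a b (fun s => (th s, c s, al s)).
Proof.
intros H.
exists (fun s => fst (fst (v s))), (fun s => snd (fst (v s))),
  (fun s => snd (v s)).
assert (E : forall s, v s = (fst (fst (v s)), snd (fst (v s)), snd (v s))).
{ intros s; now destruct (v s) as [[? ?] ?]. }
split; [exact E | now apply integral_curve_ext with v].
Qed.

(** Reduces a curve in the product space to seven real functions, to which one-variable calculus
    applies. The equality with [g] holds at every [s], even outside the interval, so it can be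
    rewritten with no side condition. *)
Lemma extremal_curve_coordinates p a b g :
  integral_curve extremal_field p a b g ->
  exists x1 x2 y z th c al : R -> R,
    (forall s, g s = ((x1 s, x2 s, y s, z s), (th s, c s, al s))) /\
    ((x1 0, x2 0, y 0, z 0), (th 0, c 0, al 0)) = p /\
    forall s, a < s < b ->
      is_derive x1 s (- cosh (th s)) /\ is_derive x2 s (sinh (th s)) /\
      is_derive y s (/ 2 * (x2 s * cosh (th s) + x1 s * sinh (th s))) /\
      is_derive z s ((x1 s ^ 2 + x2 s ^ 2) / 2 * sinh (th s)) /\
      is_derive th s (- c s) /\ is_derive c s (- al s * cosh (th s)) /\
      is_derive al s 0.
Proof.
intros H.
exists (fun s => fst (fst (fst (fst (g s))))),
  (fun s => snd (fst (fst (fst (g s))))), (fun s => snd (fst (fst (g s)))),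
  (fun s => snd (fst (g s))), (fun s => fst (fst (snd (g s)))),
  (fun s => snd (fst (snd (g s)))), (fun s => snd (snd (g s))).
match goal with |- ?A /\ _ => assert (E : A) end.
{ intros s; now destruct (g s) as [[[[? ?] ?] ?] [[? ?] ?]]. }
split; [exact E |].
destruct (integral_curve_ext _ _ _ _ _ _ E H) as [Hab [H0 Hd]].
split; [exact H0 |].
intros s Hs; specialize (Hd s Hs).
apply is_derive_pair in Hd as [Hq Hl].
apply is_derive_horizontal in Hq; apply is_derive_vertical in Hl; tauto.
Qed.

Lemma extremal_curve_intro p a b x1 x2 y z th c al :
  a < 0 < b -> ((x1 0, x2 0, y 0, z 0), (th 0, c 0, al 0)) = p ->
  (forall s, a < s < b ->
    is_derive x1 s (- cosh (th s)) /\ is_derive x2 s (sinh (th s)) /\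
    is_derive y s (/ 2 * (x2 s * cosh (th s) + x1 s * sinh (th s))) /\
    is_derive z s ((x1 s ^ 2 + x2 s ^ 2) / 2 * sinh (th s)) /\
    is_derive th s (- c s) /\ is_derive c s (- al s * cosh (th s)) /\
    is_derive al s 0) ->
  integral_curve extremal_field p a b
    (fun s => ((x1 s, x2 s, y s, z s), (th s, c s, al s))).
Proof.
intros Hab H0 Hd; split; [exact Hab | split; [exact H0 |]].
intros s Hs; specialize (Hd s Hs).
apply is_derive_pair; split.
- apply is_derive_horizontal; tauto.
- apply is_derive_vertical; tauto.
Qed.

Lemma extremal_curve_vertical q l a b g :
  integral_curve extremal_field (q, l) a b g ->
  integral_curve vertical_field l a b (fun s => snd (g s)).
Proof.
intros H.
pose proof H as [Hab _].
destruct (extremal_curve_coordinates _ _ _ _ H)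
  as [x1 [x2 [y [z [th [c [al [E [H0 Hd]]]]]]]]].
apply integral_curve_ext with (fun s => (th s, c s, al s)).
- intros s; now rewrite E.
- split; [exact Hab | split].
  + now injection H0.
  + intros s Hs; apply is_derive_vertical; specialize (Hd s Hs); tauto.
Qed.

(** * Uniqueness of integral curves forward in time *)

Lemma eq_of_is_derive (f g df : R -> R) (t : R) :
  0 <= t -> f 0 = g 0 ->
  (forall s, 0 <= s <= t -> is_derive f s (df s) /\ is_derive g s (df s)) ->
  f t = g t.
Proof.
intros [Ht | <-] H0 Hd; [| exact H0].
assert (E : f 0 - g 0 = f t - g t).
{ apply (eq_is_derive (fun s => f s - g s) 0 t); [| exact Ht].
  intros s Hs; destruct (Hd s Hs) as [Hf Hg].
  change (zero : R) with 0; rewrite <- (Rminus_diag (df s)).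
  exact (is_derive_minus f g s _ _ Hf Hg). }
lra.
Qed.

(** Gronwall's argument: [D s * exp (- K * s)] has nonpositive derivative and vanishes at 0, so it
    is nonpositive at [t], while [D t] is nonnegative. *)
Lemma gronwall_zero (D dD : R -> R) (K t : R) :
  0 <= t -> D 0 = 0 ->
  (forall s, 0 <= s <= t ->
     0 <= D s /\ is_derive D s (dD s) /\ dD s <= K * D s) ->
  D t = 0.
Proof.
intros Ht H0 Hd.
destruct (MVT_gen (fun s => D s * exp (- K * s)) 0 t
            (fun s => (dD s - K * D s) * exp (- K * s))) as [u [Hu E]].
- intros s; rewrite Rmin_left, Rmax_right by lra; intros Hs.
  destruct (Hd s ltac:(lra)) as [_ [H _]].
  auto_derive; [now exists (dD s) |].
  rewrite (is_derive_unique (fun x : R => D x) s _ H); ring.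
- intros s; rewrite Rmin_left, Rmax_right by lra; intros Hs.
  destruct (Hd s Hs) as [_ [H _]].
  apply derivable_continuous_pt, ex_derive_Reals_0.
  auto_derive; now exists (dD s).
- rewrite Rmin_left, Rmax_right in Hu by lra.
  destruct (Hd u Hu) as [_ [_ Hle]]; destruct (Hd t ltac:(lra)) as [Hpos _].
  rewrite H0 in E.
  assert (D t * exp (- K * t) <= 0).
  { replace (D t * exp (- K * t)) with
      (- ((K * D u - dD u) * exp (- K * u) * t)) by lra.
    assert (0 <= (K * D u - dD u) * exp (- K * u) * t); [| lra].
    repeat apply Rmult_le_pos; try lra; apply Rlt_le, exp_pos. }
  pose proof (exp_pos (- K * t)); nra.
Qed.

Lemma is_derive_bounded (f df : R -> R) (a b : R) :
  (forall s, a <= s <= b -> is_derive f s (df s)) ->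
  exists M, forall s, a <= s <= b -> Rabs (f s) <= M.
Proof.
intros H.
destruct (bounded_continuity f a b) as [M HM].
- intros s Hs; apply (ex_derive_continuous (V := R_NormedModule)).
  exists (df s); auto.
- exists M; intros s Hs; apply Rlt_le, (HM s Hs).
Qed.

Lemma cosh_lipschitz (B : R) :
  exists K, 0 <= K /\ forall u v, Rabs u <= B -> Rabs v <= B ->
    Rabs (cosh u - cosh v) <= K * Rabs (u - v).
Proof.
assert (Hc : forall s, is_derive cosh s (sinh s)).
{ intros s; auto_derive; [exact I | ring]. }
destruct (is_derive_bounded sinh cosh (- B) B) as [K HK].
{ intros s _; auto_derive; [exact I | ring]. }
(* For negative [B] the interval is empty and the bound [K] may be negative, hence the maximum with
   0. *)
exists (Rmax K 0); split; [apply Rmax_r |].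
intros u v Hu Hv.
apply Rabs_le_between in Hu; apply Rabs_le_between in Hv.
destruct (MVT_gen cosh v u sinh) as [w [Hw E]].
- intros s _; apply Hc.
- intros s _.
  apply derivable_continuous_pt, ex_derive_Reals_0.
  now exists (sinh s).
- rewrite E, Rabs_mult; apply Rmult_le_compat_r; [apply Rabs_pos |].
  apply Rle_trans with K; [apply HK | apply Rmax_l].
  revert Hw; unfold Rmin, Rmax; destruct (Rle_dec v u); lra.
Qed.

(** Both [alpha] coordinates stay at their common initial value. Both [theta] coordinates are
    bounded on the compact interval from 0 to [t], so [cosh] is Lipschitz on their range, and
    Gronwall applies to the squared distance in [(theta, c)]. *)
Lemma vertical_curve_unique l a b a' b' v w t :
  integral_curve vertical_field l a b v ->
  integral_curve vertical_field l a' b' w ->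
  0 <= t -> t < b -> t < b' -> v t = w t.
Proof.
intros Hv Hw Ht Htb Htb'.
destruct (vertical_curve_coordinates _ _ _ _ Hv)
  as [th [c [al [Ev [[Ha _] [H0 Hd]]]]]].
destruct (vertical_curve_coordinates _ _ _ _ Hw)
  as [th' [c' [al' [Ew [[Ha' _] [H0' Hd']]]]]].
rewrite <- H0 in H0'; injection H0' as Eth Ec Eal.
assert (D : forall s, 0 <= s <= t ->
  is_derive th s (- c s) /\ is_derive c s (- al s * cosh (th s)) /\
  is_derive al s 0).
{ intros s Hs; apply is_derive_vertical, Hd; lra. }
assert (D' : forall s, 0 <= s <= t ->
  is_derive th' s (- c' s) /\ is_derive c' s (- al' s * cosh (th' s)) /\
  is_derive al' s 0).
{ intros s Hs; apply is_derive_vertical, Hd'; lra. }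
assert (Hal : forall s, 0 <= s <= t -> al s = al 0 /\ al' s = al 0).
{ intros s Hs; split.
  - apply (eq_of_is_derive al (fun _ => al 0) (fun _ => 0)); [lra | easy |].
    intros r Hr; split; [now apply D; lra | apply @is_derive_const].
  - apply (eq_of_is_derive al' (fun _ => al 0) (fun _ => 0)); [lra | easy |].
    intros r Hr; split; [now apply D'; lra | apply @is_derive_const]. }
destruct (is_derive_bounded th (fun s => - c s) 0 t) as [B HB].
{ intros s Hs; now apply D. }
destruct (is_derive_bounded th' (fun s => - c' s) 0 t) as [B' HB'].
{ intros s Hs; now apply D'. }
destruct (cosh_lipschitz (Rmax B B')) as [K [HK0 HK]].
(* With [p], [r] the differences in [theta], [c], the derivative of [p^2 + r^2] has two terms. The
   first, [- 2 p r], is at most [p^2 + r^2], which gives the 1. The second is at most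
   [2 |alpha| K |r| |p|], which gives [|alpha| K]. *)
assert (Z : (th t - th' t) ^ 2 + (c t - c' t) ^ 2 = 0).
{ apply (gronwall_zero (fun s => (th s - th' s) ^ 2 + (c s - c' s) ^ 2)
    (fun s => - 2 * (th s - th' s) * (c s - c' s)
      - 2 * al 0 * (c s - c' s) * (cosh (th s) - cosh (th' s)))
    (1 + Rabs (al 0) * K)); [exact Ht | rewrite Eth, Ec; ring |].
  intros s Hs.
  destruct (D s Hs) as [D1 [D2 _]]; destruct (D' s Hs) as [D1' [D2' _]].
  destruct (Hal s Hs) as [Ea Ea'].
  split; [apply Rplus_le_le_0_compat; apply pow2_ge_0 | split].
  - auto_derive.
    + repeat split; eexists; eassumption.
    + rewrite (is_derive_unique (fun x : R => th x) s _ D1),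
        (is_derive_unique (fun x : R => th' x) s _ D1'),
        (is_derive_unique (fun x : R => c x) s _ D2),
        (is_derive_unique (fun x : R => c' x) s _ D2'), Ea, Ea'; ring.
  - specialize (HK (th s) (th' s)
      (Rle_trans _ _ _ (HB s Hs) (Rmax_l _ _))
      (Rle_trans _ _ _ (HB' s Hs) (Rmax_r _ _))).
    set (p := th s - th' s) in *; set (r := c s - c' s) in *.
    set (d := cosh (th s) - cosh (th' s)) in *.
    assert (A : - 2 * al 0 * r * d <= Rabs (al 0) * K * (p ^ 2 + r ^ 2)).
    { apply Rle_trans with (2 * Rabs (al 0) * Rabs r * Rabs d).
      - pose proof (Rle_abs (- (2 * al 0 * r * d))) as H.
        rewrite Rabs_Ropp, !Rabs_mult, (Rabs_pos_eq 2) in H by lra; lra.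
      - apply Rle_trans with (Rabs (al 0) * K * (2 * Rabs r * Rabs p)).
        + replace (Rabs (al 0) * K * (2 * Rabs r * Rabs p))
            with (2 * Rabs (al 0) * Rabs r * (K * Rabs p)) by ring.
          apply Rmult_le_compat_l; [| exact HK].
          repeat apply Rmult_le_pos; try apply Rabs_pos; lra.
        + apply Rmult_le_compat_l.
          * apply Rmult_le_pos; [apply Rabs_pos | exact HK0].
          * rewrite <- (pow2_abs p), <- (pow2_abs r).
            pose proof (pow2_ge_0 (Rabs p - Rabs r)); lra. }
    pose proof (pow2_ge_0 (p + r)); lra. }
destruct (Hal t ltac:(lra)) as [Ea Ea'].
rewrite Ev, Ew, Ea, Ea'.
rewrite <- !Rsqr_pow2 in Z.
destruct (Rplus_sqr_eq_0 _ _ Z).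
repeat apply (f_equal2 pair); lra.
Qed.

(** The system is triangular: once the vertical parts agree, [x1] and [x2] are integrals of
    functions of [theta], and then [y] and [z] are integrals of functions of [theta], [x1], [x2].
    Equal derivatives and equal initial values suffice at each stage. *)
Lemma extremal_curve_unique p a b a' b' g h t :
  integral_curve extremal_field p a b g ->
  integral_curve extremal_field p a' b' h ->
  0 <= t -> t < b -> t < b' -> g t = h t.
Proof.
intros Hg Hh Ht Htb Htb'.
assert (V : forall s, 0 <= s <= t -> snd (g s) = snd (h s)).
{ destruct p as [q l]; intros s Hs.
  apply (vertical_curve_unique l a b a' b'
    (fun s => snd (g s)) (fun s => snd (h s))); try lra;
  now apply (extremal_curve_vertical q). }
pose proof Hg as [Ha _]; pose proof Hh as [Ha' _].
destruct (extremal_curve_coordinates _ _ _ _ Hg)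
  as [x1 [x2 [y [z [th [c [al [Eg [H0 Hd]]]]]]]]].
destruct (extremal_curve_coordinates _ _ _ _ Hh)
  as [x1' [x2' [y' [z' [th' [c' [al' [Eh [H0' Hd']]]]]]]]].
rewrite <- H0 in H0'; injection H0' as E1 E2 Ey Ez _ _ _.
assert (Eth : forall s, 0 <= s <= t -> th s = th' s).
{ intros s Hs; specialize (V s Hs); rewrite Eg, Eh in V.
  simpl in V; congruence. }
assert (X1 : forall s, 0 <= s <= t -> x1 s = x1' s).
{ intros s Hs; apply eq_of_is_derive with (fun r => - cosh (th r));
    [lra | easy |].
  intros r Hr; split; [apply Hd; lra |].
  rewrite Eth by lra; apply Hd'; lra. }
assert (X2 : forall s, 0 <= s <= t -> x2 s = x2' s).
{ intros s Hs; apply eq_of_is_derive with (fun r => sinh (th r));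
    [lra | easy |].
  intros r Hr; split; [apply Hd; lra |].
  rewrite Eth by lra; apply Hd'; lra. }
assert (Y : y t = y' t).
{ apply eq_of_is_derive with
    (fun r => / 2 * (x2 r * cosh (th r) + x1 r * sinh (th r))); [lra | easy |].
  intros r Hr; split; [apply Hd; lra |].
  rewrite Eth, X1, X2 by lra; apply Hd'; lra. }
assert (Z : z t = z' t).
{ apply eq_of_is_derive with
    (fun r => (x1 r ^ 2 + x2 r ^ 2) / 2 * sinh (th r)); [lra | easy |].
  intros r Hr; split; [apply Hd; lra |].
  rewrite Eth, X1, X2 by lra; apply Hd'; lra. }
specialize (V t ltac:(lra)); rewrite Eg, Eh in V; rewrite Eg, Eh; simpl in V.
rewrite X1, X2, Y, Z by lra; now f_equal.
Qed.

(** * Computing [flow] and [Exp] from any integral curve *)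

(** The curve [g] shows that the choice made by [epsilon] is of a value actually attained at time
    [t]; the uniqueness hypothesis then identifies that value with [g t]. *)
Lemma flow_integral_curve {V : NormedModule R_AbsRing} (X : V -> V) (x0 : V)
    (a b t : R) (g : R -> V) :
  integral_curve X x0 a b g -> a < t < b ->
  (forall a' b' h, integral_curve X x0 a' b' h -> a' < t < b' -> g t = h t) ->
  flow X t x0 = g t.
Proof.
intros Hg Ht U; unfold flow.
match goal with |- epsilon ?i ?P = _ =>
  assert (H : P (epsilon i P)) by
    (apply epsilon_spec; exists (g t), a, b, g; auto) end.
destruct H as [a' [b' [h [Hh [Ht' E]]]]].
rewrite <- E; symmetry; now apply (U a' b').
Qed.

Lemma flow_vertical l a b v t :
  integral_curve vertical_field l a b v -> 0 <= t < b ->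
  flow vertical_field t l = v t.
Proof.
intros Hv Ht; pose proof Hv as [Ha _].
apply (flow_integral_curve _ _ a b t v Hv); [lra |].
intros a' b' h Hh Ht'.
apply (vertical_curve_unique l a b a' b'); auto; lra.
Qed.

(** A single curve that outlasts [t] settles both membership in the domain, since [b] is at most the
    explosion time, and the value of [Exp]. Each symmetry thus only requires exhibiting a curve. *)
Lemma Exp_integral_curve (l : Costate) a b g t :
  integral_curve extremal_field (engel_origin, l) a b g -> 0 < t < b ->
  exp_domain (l, t) /\ Exp (l, t) = fst (g t).
Proof.
intros Hg Ht; pose proof Hg as [Ha _]; split.
- split; [tauto |].
  apply Rbar_lt_le_trans with b; [simpl; tauto |].
  apply Lub_Rbar_correct; now exists a, g.
- unfold Exp; f_equal.
  apply (flow_integral_curve _ _ a b t g Hg); [lra |].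
  intros a' b' h Hh Ht'.
  apply (extremal_curve_unique _ a b a' b' g h t Hg Hh); lra.
Qed.

(** If no curve lasted beyond [t], then [t] would bound all right ends, and the explosion time,
    their least upper bound, would be at most [t]. *)
Lemma exp_domain_integral_curve (l : Costate) t :
  exp_domain (l, t) ->
  0 < t /\ exists a b g,
    integral_curve extremal_field (engel_origin, l) a b g /\ t < b.
Proof.
intros [Ht Hlt]; split; [exact Ht |].
apply Classical_Prop.NNPP; intros N.
apply (Rbar_lt_not_le _ _ Hlt), Lub_Rbar_correct.
intros b [a [g Hg]]; simpl; apply Rnot_lt_le; intros Hb.
now apply N; exists a, b, g.
Qed.

(** * Action of the symmetries on trajectories *)

Lemma extremal_curve_eps1 l a b g :
  integral_curve extremal_field (engel_origin, l) a b g ->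
  integral_curve extremal_field (engel_origin, epsC1 l) a b
    (fun s => (epsM1 (fst (g s)), epsC1 (snd (g s)))).
Proof.
intros H; pose proof H as [Ha _].
destruct (extremal_curve_coordinates _ _ _ _ H)
  as [x1 [x2 [y [z [th [c [al [E [H0 Hd]]]]]]]]].
apply integral_curve_ext with (fun s =>
  ((x1 s, - x2 s, - y s, - z s), (- th s, - c s, - al s))).
{ intros s; now rewrite E. }
injection H0 as E1 E2 Ey Ez El.
apply (extremal_curve_intro _ a b x1 (fun s => - x2 s) (fun s => - y s)
  (fun s => - z s) (fun s => - th s) (fun s => - c s) (fun s => - al s));
  [exact Ha | |].
- rewrite <- El, E1, E2, Ey, Ez, !Ropp_0; reflexivity.
- intros s Hs; destruct (Hd s Hs) as [D1 [D2 [Dy [Dz [Dth [Dc Dal]]]]]].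
  assert (Ch : cosh (- th s) = cosh (th s)).
  { unfold cosh; rewrite Ropp_involutive; lra. }
  assert (Sh : sinh (- th s) = - sinh (th s)).
  { unfold sinh; rewrite Ropp_involutive; lra. }
  rewrite Ch, Sh.
  apply @is_derive_opp in D2, Dy, Dz, Dth, Dc, Dal.
  repeat match goal with |- _ /\ _ => split end;
    (evar_last; [eassumption | unfold opp; simpl; field]).
Qed.

(** The lift of the reversed vertical trajectory, where [(X1, X2, Y, Z)] is
    the value at time [t] and [(x1, x2, y, z)] the value at time [t - s].  The
    formulas come from integrating the horizontal equations, using
    [x1 * x2' = y' + (x1 * x2 / 2)']. *)
Definition reversed_lift (Q q : Engel) : Engel :=
  let '(X1, X2, Y, Z) := Q in
  let '(x1, x2, y, z) := q in
  (X1 - x1, X2 - x2, y - Y + / 2 * (X2 * x1 - X1 * x2),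
   Z - z + (X1 ^ 2 + X2 ^ 2) / 2 * (X2 - x2)
   - X1 * (Y - y + / 2 * (X1 * X2 - x1 * x2)) - X2 * (X2 ^ 2 - x2 ^ 2) / 2).

Lemma reversed_lift_origin (Q : Engel) : reversed_lift Q engel_origin = epsM2 Q.
Proof.
destruct Q as [[[X1 X2] Y] Z]; unfold reversed_lift, engel_origin, epsM2.
repeat apply (f_equal2 pair); field.
Qed.

(** Reversal maps the interval from [a] to [b] onto the one from [t - b] to [t - a]. The latter
    contains 0 because [a < t < b], and reaches strictly beyond [t] because [a < 0]. *)
Lemma extremal_curve_reverse l a b g t :
  integral_curve extremal_field (engel_origin, l) a b g -> a < t < b ->
  integral_curve extremal_field (engel_origin, epsC2 (snd (g t)))
    (t - b) (t - a)
    (fun s => (reversed_lift (fst (g t)) (fst (g (t - s))),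
               epsC2 (snd (g (t - s))))).
Proof.
intros H Ht.
destruct (extremal_curve_coordinates _ _ _ _ H)
  as [x1 [x2 [y [z [th [c [al [E [H0 Hd]]]]]]]]].
set (Z := fun s => z t - z (t - s)
   + (x1 t ^ 2 + x2 t ^ 2) / 2 * (x2 t - x2 (t - s))
   - x1 t * (y t - y (t - s) + / 2 * (x1 t * x2 t - x1 (t - s) * x2 (t - s)))
   - x2 t * (x2 t ^ 2 - x2 (t - s) ^ 2) / 2).
apply integral_curve_ext with (fun s =>
  ((x1 t - x1 (t - s), x2 t - x2 (t - s),
    y (t - s) - y t + / 2 * (x2 t * x1 (t - s) - x1 t * x2 (t - s)), Z s),
   (th (t - s), - c (t - s), al (t - s)))).
{ intros s; now rewrite !E. }
apply (extremal_curve_intro _ (t - b) (t - a)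
  (fun s => x1 t - x1 (t - s)) (fun s => x2 t - x2 (t - s))
  (fun s => y (t - s) - y t + / 2 * (x2 t * x1 (t - s) - x1 t * x2 (t - s))) Z
  (fun s => th (t - s)) (fun s => - c (t - s)) (fun s => al (t - s))).
- lra.
- unfold Z; rewrite E, Rminus_0_r; unfold engel_origin, epsC2; simpl.
  repeat apply (f_equal2 pair); field.
- intros s Hs.
  destruct (Hd (t - s) ltac:(lra)) as [D1 [D2 [Dy [Dz [Dth [Dc Dal]]]]]].
  (* These equations replace the formal derivatives left by [auto_derive] with the right-hand sides
     at time [t - s]; what remains are field identities in the coordinates, [cosh] and [sinh]. *)
  assert (U1 := is_derive_unique (fun u : R => x1 u) _ _ D1).
  assert (U2 := is_derive_unique (fun u : R => x2 u) _ _ D2).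
  assert (Uy := is_derive_unique (fun u : R => y u) _ _ Dy).
  assert (Uz := is_derive_unique (fun u : R => z u) _ _ Dz).
  assert (Uth := is_derive_unique (fun u : R => th u) _ _ Dth).
  assert (Uc := is_derive_unique (fun u : R => c u) _ _ Dc).
  assert (Ual := is_derive_unique (fun u : R => al u) _ _ Dal).
  repeat match goal with |- _ /\ _ => split end;
    (unfold Z; auto_derive; [repeat split; eexists; eassumption |]);
    change (t + - s) with (t - s);
    rewrite ?U1, ?U2, ?Uy, ?Uz, ?Uth, ?Uc, ?Ual; field.
Qed.

Lemma epsC3_comp (l : Costate) : epsC3 l = epsC1 (epsC2 l).
Proof.
destruct l as [[th c] al]; simpl; now rewrite Ropp_involutive.
Qed.

Lemma epsM3_comp (q : Engel) : epsM3 q = epsM1 (epsM2 q).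
Proof.
destruct q as [[[x1 x2] y] z]; simpl.
repeat apply (f_equal2 pair); ring.
Qed.

Theorem proposition1 (theta c alpha t : R)
  (hN : exp_domain (theta, c, alpha, t)) :
  (exp_domain (epsN1 (theta, c, alpha, t)) /\
   epsM1 (Exp (theta, c, alpha, t)) = Exp (epsN1 (theta, c, alpha, t))) /\
  (exp_domain (epsN2 (theta, c, alpha, t)) /\
   epsM2 (Exp (theta, c, alpha, t)) = Exp (epsN2 (theta, c, alpha, t))) /\
  (exp_domain (epsN3 (theta, c, alpha, t)) /\
   epsM3 (Exp (theta, c, alpha, t)) = Exp (epsN3 (theta, c, alpha, t))).
Proof.
pose (l := (theta, c, alpha) : Costate).
change (exp_domain (l, t)) in hN.
destruct (exp_domain_integral_curve l t hN) as [Ht [a [b [g [Hg Htb]]]]].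
pose proof Hg as [Ha [H0 _]].
destruct (Exp_integral_curve l a b g t Hg ltac:(lra)) as [_ EE].
(* The costate moved by the vertical flow is the final costate of [g], which is where the reversed
   curve starts up to [epsC2]. *)
assert (EV : flow vertical_field t l = snd (g t)).
{ apply (flow_vertical l a b (fun s => snd (g s)) t); [| lra].
  now apply (extremal_curve_vertical engel_origin). }
pose proof (extremal_curve_reverse l a b g t Hg ltac:(lra)) as Hr.
(* At [s = t] the reversed curve reads [g] at time 0, where the horizontal part is the origin. *)
assert (Er : reversed_lift (fst (g t)) (fst (g (t - t))) = epsM2 (fst (g t))).
{ rewrite Rminus_diag, H0; apply reversed_lift_origin. }
split; [| split].
- destruct (Exp_integral_curve _ _ _ _ t (extremal_curve_eps1 _ _ _ _ Hg)
    ltac:(lra)) as [HD HE].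
  split; [exact HD |].
  change (epsM1 (Exp (l, t)) = Exp (epsC1 l, t)); rewrite EE; now symmetry.
- change (exp_domain (epsC2 (flow vertical_field t l), t) /\
    epsM2 (Exp (l, t)) = Exp (epsC2 (flow vertical_field t l), t)).
  rewrite EV.
  destruct (Exp_integral_curve _ _ _ _ t Hr ltac:(lra)) as [HD HE].
  split; [exact HD |].
  rewrite EE; symmetry; etransitivity; [exact HE | exact Er].
- change (exp_domain (epsC3 (flow vertical_field t l), t) /\
    epsM3 (Exp (l, t)) = Exp (epsC3 (flow vertical_field t l), t)).
  rewrite EV.
  (* The reversed curve [Hr] again starts over the origin, so the first symmetry can be applied to
     it. *)
  destruct (Exp_integral_curve _ _ _ _ t (extremal_curve_eps1 _ _ _ _ Hr)
    ltac:(lra)) as [HD HE].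
  rewrite epsC3_comp, EE, epsM3_comp; split; [exact HD |].
  symmetry; etransitivity; [exact HE | exact (f_equal epsM1 Er)].
Qed.
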